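(* In intensional Martin-Löf type theory with weak propositional truncation, for every type $X:\mathcal U$ there is a function $\lVert X\rVert\to\mathrm{Pop}(X)$, where $\mathrm{Pop}(X):\equiv\prod_{f:X\to X}\Big(\big(\prod_{x,y:X}f(x)=f(y)\big)\to\sum_{x:X}x=f(x)\Big)$.
   Context: Intensional Martin-Löf type theory with a universe $\mathcal U$, $\Sigma$, $\Pi$, $+$ and identity types (J only; no UIP/K). $\mathrm{isProp}(A):\equiv\prod_{a,b:A}a=b$. Weak propositional truncation: for every $A:\mathcal U$ a type $\lVert A\rVert:\mathcal U$ with $|{-}|:A\to\lVert A\rVert$, a proof of $\mathrm{isProp}(\lVert A\rVert)$, and $\mathrm{rec}:\prod_{P:\mathcal U}\mathrm{isProp}(P)\to(A\to P)\to\lVert A\rVert\to P$ (no judgmental computation rule). $\mathrm{Pop}(X)$ (''$X$ is populated'') says every weakly constant endomap on $X$ has a fixed point. *)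

(* Defs.v *)
(** One fixed universe: every type former below stays inside [U], and the
    truncation eliminates into types of that same universe. *)
Definition U := Type.

(** The identity type is valued in [U], as in Martin-Löf type theory, and not in
    [Prop] like [eq]. *)
Inductive Id {A : U} (a : A) : A -> U :=
  refl : Id a a.

Arguments refl {A a}.

Definition isProp (A : U) : U := forall a b : A, Id a b.

(** No computation rule relating [rec] and [tr] is required. *)
Record weak_truncation := {
  trunc : U -> U;
  tr : forall A : U, A -> trunc A;
  trunc_isProp : forall A : U, isProp (trunc A);
  rec : forall A P : U, isProp P -> (A -> P) -> trunc A -> P
}.

Definition Pop (X : U) : U :=
  forall f : X -> X, (forall x y : X, Id (f x) (f y)) -> {x : X & Id x (f x)}.

(* Main.v *)
(** Kraus' fixed point lemma: the type of fixed points of a weakly constant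
    endomap [f] is a proposition. Weak constancy makes [ap f] trivial on loops, so
    two fixed-point witnesses [p q : x = f x] are identified by transporting [p]
    along the loop [p . q^-1]; witnesses over different points reduce to this case
    because any two fixed points are equal. The recursor of the truncation thus
    applies to the map sending [x] to the fixed point [f x]. *)
Require Import Defs.

Definition sym {A : U} {a b : A} (p : Id a b) : Id b a :=
  match p with refl => refl end.

Definition trans {A : U} {a b c : A} (p : Id a b) (q : Id b c) : Id a c :=
  match q with refl => p end.

Definition ap {A B : U} (f : A -> B) {a b : A} (p : Id a b) : Id (f a) (f b) :=
  match p with refl => refl end.

Definition weakly_constant {A B : U} (f : A -> B) : U :=
  forall x y : A, Id (f x) (f y).

Definition Fix {X : U} (f : X -> X) : U := {x : X & Id x (f x)}.

Definition trans_sym_l {A : U} {a b : A} (p : Id a b) : Id refl (trans (sym p) p) :=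
  match p with refl => refl end.

Lemma sym_trans_sym_trans {A : U} {a b c : A} (p : Id a b) (q : Id c b) :
  Id (trans (sym (trans p (sym q))) p) q.
Proof. destruct q, p; exact refl. Defined.

(* Stated for paths with free endpoint, so that path induction applies; on a loop the
   right-hand side no longer depends on [p]. *)
Lemma ap_weakly_constant {A B : U} (f : A -> B) (k : weakly_constant f) {x y : A}
    (p : Id x y) : Id (trans (sym (k x x)) (k x y)) (ap f p).
Proof. destruct p; exact (sym (trans_sym_l (k x x))). Defined.

Lemma ap_weakly_constant_loop {A B : U} (f : A -> B) (k : weakly_constant f) {x : A}
    (p : Id x x) : Id refl (ap f p).
Proof.
  exact (trans (trans_sym_l (k x x)) (ap_weakly_constant f k p)).
Defined.

(** Both ends of [p] move with the point, one along [s], the other along [ap f s]. *)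
Lemma Fix_transport {X : U} (f : X -> X) {x y : X} (s : Id x y) (p : Id x (f x)) :
  Id (existT _ x p : Fix f) (existT _ y (trans (trans (sym s) p) (ap f s))).
Proof.
  destruct s; simpl.
  (* Only the left unit law is left; generalizing the endpoint [f x] to [z] permits induction on
     [p]. *)
  exact (ap (fun q => existT _ x q : Fix f)
            (match p as p' in Id _ z return Id p' (trans refl p') with
             | refl => refl end)).
Defined.

Lemma Fix_eq_same_point {X : U} (f : X -> X) (k : weakly_constant f) {x : X}
    (p q : Id x (f x)) : Id (existT _ x p : Fix f) (existT _ x q).
Proof.
  set (s := trans p (sym q)).
  refine (trans (Fix_transport f s p) (ap (fun r => existT _ x r : Fix f) _)).
  (* This turns [ap f s] into [refl], which [trans] absorbs on the right by computation. *)
  destruct (ap_weakly_constant_loop f k s).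
  exact (sym_trans_sym_trans p q).
Defined.

Lemma isProp_Fix {X : U} (f : X -> X) (k : weakly_constant f) : isProp (Fix f).
Proof.
  intros [x p] [y q].
  (* The path runs from [x] through [f x] and [f y] to [y]. *)
  pose proof (trans (trans p (k x y)) (sym q)) as s.
  destruct s; exact (Fix_eq_same_point f k p q).
Defined.

Theorem theorem6p2 (T : weak_truncation) (X : U) : trunc T X -> Pop X.
Proof.
  intros t f k.
  exact (rec T X (Fix f) (isProp_Fix f k) (fun x => existT _ (f x) (k x (f x))) t).
Qed.
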